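(* For each $\beta\in\mathbb{Q}\cap[0,1/2]$, the elements $S_\beta$ and $T_\beta$ of $\mathrm{PSL}_2(\mathbb{Q}(x))$ belong to the subgroup $$\Gamma=\left\langle U_0,W_0\right\rangle,\qquad U_0=\begin{bmatrix}1&-1\\0&1\end{bmatrix},\quad W_0=\begin{bmatrix}1&0\\-1/x&1\end{bmatrix}.$$
   Context: $\mathbb{Q}_0=\mathbb{Q}\cap[0,1]$, $\widehat{\mathbb{Q}}_0=\mathbb{Q}_0\cup\{\infty\}$; fractions are in lowest terms with positive denominator, $0=0/1$, $1=1/1$, $\infty=1/0$. A pair $\{p/q,r/s\}\subset\widehat{\mathbb{Q}}_0$ is a Farey pair if $ps-rq=\pm1$; $p/q\oplus r/s=(p+r)/(q+s)$; $\gamma\oplus^0\beta=\gamma$, $\gamma\oplus^j\beta=(\gamma\oplus^{j-1}\beta)\oplus\beta$. $d_{\mathcal Q}(p/q)=(-1)^px^q$. $\mathcal{Q},\mathcal{N}:\widehat{\mathbb{Q}}_0\to\mathbb{Z}[x]$ are the unique functions with $\mathcal{Q}(0)=1,\mathcal{Q}(\infty)=0,\mathcal{Q}(1)=1$, $\mathcal{N}(0)=\mathcal{N}(\infty)=\mathcal{N}(1)=1$, and $\mathcal{F}(\gamma\oplus^2\beta)=-d_{\mathcal Q}(\beta)\mathcal{F}(\gamma)+\mathcal{Q}(\beta)\mathcal{F}(\gamma\oplus\beta)$ for $\mathcal F\in\{\mathcal Q,\mathcal N\}$ and every Farey pair $\{\beta,\gamma\}$ with $\gamma\oplus^2\beta\in\mathbb{Q}_0$.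 For $\omega\in\mathbb{Q}_0$ put $V=\mathcal{N}(\omega)/\mathcal{Q}(\omega)$, $$W_\omega=\begin{bmatrix}1&0\\-\mathcal{Q}(\omega)^2/d_{\mathcal Q}(\omega)&1\end{bmatrix},\quad U_\omega=\begin{bmatrix}1&-V\\0&1\end{bmatrix},\quad T_\omega=U_\omega^{-1}W_\omega^{-1}U_\omega,\quad S_\omega=T_\omega^{-1}U_0^{-1}$$ in $\mathrm{PSL}_2(\mathbb{Q}(x))$. *)

(* Defs.v *)
From HB Require Import structures.
From mathcomp Require Import all_boot all_order all_algebra.

Set Implicit Arguments.
Unset Strict Implicit.
Unset Printing Implicit Defensive.

Import GRing.Theory Num.Theory.

Local Open Scope ring_scope.
Local Open Scope quotient_scope.

Section Mx2.
Variable R : comNzRingType.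

Definition mx2 (a b c d : R) : 'M[R]_2 :=
  \matrix_(i, j) nth 0 (nth [::] [:: [:: a; b]; [:: c; d]] i) j.

Lemma det_mx2 (a b c d : R) : \det (mx2 a b c d) = a * d - b * c.
Proof.
rewrite (expand_det_row _ 0) !big_ord_recl big_ord0 addr0 /cofactor.
rewrite !det_mx11 !mxE /= !expr0 expr1 !mul1r.
by rewrite mulN1r mulrN.
Qed.

End Mx2.

Record SL2 (F : fieldType) : Type :=
  MkSL2 { SL2val :> 'M[F]_2; SL2valP : \det SL2val == 1 }.

HB.instance Definition _ (F : fieldType) := [isSub for @SL2val F].
HB.instance Definition _ (F : fieldType) := [Choice of SL2 F by <:].

Section SL2Group.
Variable F : fieldType.
Implicit Types A B C : SL2 F.

Lemma det_SL2 A : \det (val A) = 1.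
Proof. exact/eqP/SL2valP. Qed.

Lemma SL2_unit A : val A \in unitmx.
Proof. by rewrite unitmxE det_SL2 unitr1. Qed.

Fact SL2_one_subproof : \det (1%:M : 'M[F]_2) == 1.
Proof. by rewrite det1. Qed.

Fact SL2_mul_subproof A B : \det (val A *m val B) == 1.
Proof. by rewrite det_mulmx !det_SL2 mulr1. Qed.

Fact SL2_inv_subproof A : \det (invmx (val A)) == 1.
Proof. by rewrite det_inv det_SL2 invr1. Qed.

Fact SL2_opp_subproof A : \det (- val A) == 1.
Proof. by rewrite -scaleN1r detZ det_SL2 mulr1 sqrrN expr1n. Qed.

Definition SL2_one : SL2 F := MkSL2 SL2_one_subproof.
Definition SL2_mul A B : SL2 F := MkSL2 (SL2_mul_subproof A B).
Definition SL2_inv A : SL2 F := MkSL2 (SL2_inv_subproof A).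
Definition SL2_opp A : SL2 F := MkSL2 (SL2_opp_subproof A).

Fact SL2_mulA : associative SL2_mul.
Proof. by move=> A B C; apply: val_inj; rewrite /= mulmxA. Qed.

Fact SL2_mul1 : left_id SL2_one SL2_mul.
Proof. by move=> A; apply: val_inj; rewrite /= mul1mx. Qed.

Fact SL2_mulr1 : right_id SL2_one SL2_mul.
Proof. by move=> A; apply: val_inj; rewrite /= mulmx1. Qed.

Fact SL2_mulV : left_inverse SL2_one SL2_inv SL2_mul.
Proof. by move=> A; apply: val_inj; rewrite /= mulVmx ?SL2_unit. Qed.

Fact SL2_mulrV : right_inverse SL2_one SL2_inv SL2_mul.
Proof. by move=> A; apply: val_inj; rewrite /= mulmxV ?SL2_unit. Qed.

HB.instance Definition _ :=
  isGroup.Build (SL2 F) SL2_mulA SL2_mul1 SL2_mulr1 SL2_mulV SL2_mulrV.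

Definition PSL2_rel A B : bool := (B == A) || (B == SL2_opp A).

Lemma SL2_oppK : involutive SL2_opp.
Proof. by move=> A; apply: val_inj; rewrite /= opprK. Qed.

Fact PSL2_rel_refl : reflexive PSL2_rel.
Proof. by move=> A; rewrite /PSL2_rel eqxx. Qed.

Fact PSL2_rel_sym : symmetric PSL2_rel.
Proof.
move=> A B; rewrite /PSL2_rel eq_sym; congr (_ || _).
by apply/eqP/eqP => ->; rewrite SL2_oppK.
Qed.

Fact PSL2_rel_trans : transitive PSL2_rel.
Proof.
move=> B A C /orP[/eqP->//|/eqP->] /orP[/eqP->|/eqP->].
  by rewrite /PSL2_rel eqxx orbT.
by rewrite SL2_oppK PSL2_rel_refl.
Qed.

Canonical PSL2_equiv :=
  EquivRel PSL2_rel PSL2_rel_refl PSL2_rel_sym PSL2_rel_trans.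

End SL2Group.

Definition PSL2 (F : fieldType) : Type := {eq_quot @PSL2_rel F}.

HB.instance Definition _ (F : fieldType) := EqQuotient.on (PSL2 F).
HB.instance Definition _ (F : fieldType) := Choice.on (PSL2 F).

Section PSL2Group.
Variable F : fieldType.
Local Notation G := (PSL2 F).

Lemma PSL2_eqP (A B : SL2 F) :
  reflect (B = A \/ B = SL2_opp A) (\pi_G A == \pi_G B).
Proof.
rewrite eqmodE /= /PSL2_rel.
by apply: (iffP orP) => -[] /eqP; auto.
Qed.

Fact PSL2_pi_mul (A A' B B' : SL2 F) :
  \pi_G A = \pi_G A' -> \pi_G B = \pi_G B' ->
  \pi_G (SL2_mul A B) = \pi_G (SL2_mul A' B').
Proof.
move=> /eqP/PSL2_eqP hA /eqP/PSL2_eqP hB; apply/eqP/PSL2_eqP.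
case: hA => ->; case: hB => ->; [left|right|right|left]; apply: val_inj => //=.
- by rewrite mulmxN.
- by rewrite mulNmx.
- by rewrite mulNmx mulmxN opprK.
Qed.

Fact PSL2_pi_inv (A A' : SL2 F) :
  \pi_G A = \pi_G A' -> \pi_G (SL2_inv A) = \pi_G (SL2_inv A').
Proof.
move=> /eqP/PSL2_eqP hA; apply/eqP/PSL2_eqP.
case: hA => ->; [by left | right]; apply: val_inj => /=.
have uA : - 1 *: val A \in unitmx.
  by rewrite scaleN1r -[- _]/(val (SL2_opp A)) SL2_unit.
by rewrite -scaleN1r invmxZ // invrN1 scaleN1r.
Qed.

Lemma PSL2W (P : G -> Prop) : (forall A, P (\pi_G A)) -> forall a, P a.
Proof. by move=> hP a; rewrite -[a]reprK. Qed.

Definition PSL2_one : G := \pi_G (SL2_one F).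
Definition PSL2_mul (a b : G) : G := \pi_G (SL2_mul (repr a) (repr b)).
Definition PSL2_inv (a : G) : G := \pi_G (SL2_inv (repr a)).

Lemma PSL2_mulE (A B : SL2 F) :
  PSL2_mul (\pi_G A) (\pi_G B) = \pi_G (SL2_mul A B).
Proof. by apply: PSL2_pi_mul; rewrite reprK. Qed.

Lemma PSL2_invE (A : SL2 F) : PSL2_inv (\pi_G A) = \pi_G (SL2_inv A).
Proof. by apply: PSL2_pi_inv; rewrite reprK. Qed.

Fact PSL2_mulA : associative PSL2_mul.
Proof.
elim/PSL2W=> A; elim/PSL2W=> B; elim/PSL2W=> C.
by rewrite !PSL2_mulE SL2_mulA.
Qed.

Fact PSL2_mul1 : left_id PSL2_one PSL2_mul.
Proof. by elim/PSL2W=> A; rewrite PSL2_mulE SL2_mul1. Qed.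

Fact PSL2_mulr1 : right_id PSL2_one PSL2_mul.
Proof. by elim/PSL2W=> A; rewrite PSL2_mulE SL2_mulr1. Qed.

Fact PSL2_mulV : left_inverse PSL2_one PSL2_inv PSL2_mul.
Proof. by elim/PSL2W=> A; rewrite PSL2_invE PSL2_mulE SL2_mulV. Qed.

Fact PSL2_mulrV : right_inverse PSL2_one PSL2_inv PSL2_mul.
Proof. by elim/PSL2W=> A; rewrite PSL2_invE PSL2_mulE SL2_mulrV. Qed.

HB.instance Definition _ :=
  isGroup.Build (PSL2 F) PSL2_mulA PSL2_mul1 PSL2_mulr1 PSL2_mulV PSL2_mulrV.

Lemma PSL2_piM (A B : SL2 F) : (\pi_G A * \pi_G B)%g = \pi_G (A * B)%g.
Proof. exact: PSL2_mulE. Qed.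

Lemma PSL2_piV (A : SL2 F) : ((\pi_G A)^-1)%g = \pi_G (A^-1)%g.
Proof. exact: PSL2_invE. Qed.

Fact det_upper (a : F) : \det (mx2 1 a 0 1) == 1.
Proof. by rewrite det_mx2 mulr1 mulr0 subr0. Qed.

Fact det_lower (a : F) : \det (mx2 1 0 a 1) == 1.
Proof. by rewrite det_mx2 mulr1 mul0r subr0. Qed.

Definition PSL2_upper (a : F) : PSL2 F := \pi_G (MkSL2 (det_upper a)).
Definition PSL2_lower (a : F) : PSL2 F := \pi_G (MkSL2 (det_lower a)).

End PSL2Group.

Inductive generated (G : groupType) (A : G -> Prop) : G -> Prop :=
| generated_mem g : A g -> generated A g
| generated_1 : generated A 1%g
| generated_M g h : generated A g -> generated A h -> generated A (g * h)%g
| generated_V g : generated A g -> generated A (g^-1)%g.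

(* [Some r] is the rational r and [None] is infinity = 1/0. *)
Definition erat : Type := option rat.

Definition fnum (a : erat) : int := if a is Some r then numq r else 1.
Definition fden (a : erat) : int := if a is Some r then denq r else 0.

Definition inQ0 (r : rat) : bool := 0 <= r <= 1.
Definition inQ0hat (a : erat) : bool := if a is Some r then inQ0 r else true.

Definition farey_pair (a b : erat) : Prop :=
  [/\ inQ0hat a, inQ0hat b &
      let D := fnum a * fden b - fnum b * fden a in D = 1 \/ D = - 1].

(* For a Farey pair the mediant is already in lowest terms, so its [fnum] and [fden]
   are the sums themselves. *)
Definition oplus (a b : erat) : erat :=
  let d := fden a + fden b in
  if d == 0 then None else Some ((fnum a + fnum b)%:Q / d%:Q).

Definition oplusn (j : nat) (g b : erat) : erat :=
  iter j (fun d => oplus d b) g.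

(* Numerators are nonnegative on the domain, so absz is only a cast to nat. *)
Definition dQ (a : erat) : {poly int} :=
  (-1) ^+ `|fnum a|%N * 'X^(`|fden a|%N).

Definition farey_rec (Q F : erat -> {poly int}) : Prop :=
  forall b g : erat, farey_pair b g ->
    (exists2 r : rat, oplusn 2 g b = Some r & inQ0 r) ->
    F (oplusn 2 g b) = - dQ b * F g + Q b * F (oplusn 1 g b).

(* These conditions determine Q and N on the extended set [inQ0hat]; the
   values elsewhere are unconstrained. *)
Record farey_QN (Q N : erat -> {poly int}) : Prop := FareyQN {
  Q_0 : Q (Some 0) = 1;
  Q_inf : Q None = 0;
  Q_1 : Q (Some 1) = 1;
  N_0 : N (Some 0) = 1;
  N_inf : N None = 1;
  N_1 : N (Some 1) = 1;
  Q_rec : farey_rec Q Q;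
  N_rec : farey_rec Q N }.

Definition Qx : fieldType := {fraction {poly rat}}.

Definition toQx (p : {poly int}) : Qx := tofrac (map_poly intr p).

Section Elements.
Variables Q N : erat -> {poly int}.

(* [Q w] has constant term 1 for w in [0, 1], so the division is genuine. *)
Definition V_val (w : rat) : Qx := toQx (N (Some w)) / toQx (Q (Some w)).

Definition W_elt (w : rat) : PSL2 Qx :=
  PSL2_lower (- (toQx (Q (Some w)) ^+ 2 / toQx (dQ (Some w)))).
Definition U_elt (w : rat) : PSL2 Qx := PSL2_upper (- V_val w).
Definition T_elt (w : rat) : PSL2 Qx := ((U_elt w)^-1 * (W_elt w)^-1 * U_elt w)%g.
Definition S_elt (w : rat) : PSL2 Qx := ((T_elt w)^-1 * (U_elt 0)^-1)%g.

End Elements.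

Definition U0 : PSL2 Qx := PSL2_upper (- 1).
Definition W0 : PSL2 Qx := PSL2_lower (- (1 / toQx 'X)).

Definition Gamma : PSL2 Qx -> Prop :=
  generated (fun g => g = U0 \/ g = W0).

Lemma U_at0 (Q N : erat -> {poly int}) : farey_QN Q N -> U_elt Q N 0 = U0.
Proof.
by move=> h; rewrite /U_elt /V_val /toQx (Q_0 h) (N_0 h) !rmorph1 divr1.
Qed.

Lemma W_at0 (Q N : erat -> {poly int}) : farey_QN Q N -> W_elt Q 0 = W0.
Proof.
move=> h; rewrite /W_elt /toQx (Q_0 h) !rmorph1 expr1n.
by rewrite [dQ _]mul1r.
Qed.

(* Main.v *)
Require Import Defs.
From mathcomp Require Import all_boot all_order all_algebra.
From mathcomp Require Import ring zify.

Set Implicit Arguments.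
Unset Strict Implicit.
Unset Printing Implicit Defensive.

Import Order.TTheory GRing.Theory Num.Theory.

Local Open Scope ring_scope.
Local Open Scope quotient_scope.

(** Why the theorem holds. Attach to a slope [a] the vector [v_a = (N a, Q a)].
    Then [T_a] is the transvection [1 + d_a^-1 v_a (Q a, - N a)], a parabolic
    fixing [v_a] ([T_eltE]). The same formula at infinity gives [U_0^-1], which
    is therefore [T_oo].

    Conjugating a transvection moves its vector and keeps its coefficient, and
    the pair (coefficient, vector) matters only up to (c^2 e, v) ~ (e, c v). So
    it is enough to see the Farey recursion, up to scalars, as the action of
    elements already known to lie in Gamma. For a Farey pair a < b with mediant
    m, it reads [v_(a+m) = - d_a v_b + Q a v_m], and the right-hand side is
    [- d_a T_a^-1 T_oo v_b]; on the other side,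
    [v_(m+b) = - d_b T_b T_oo^-1 v_a]. As [d_(a+m) = d_a^2 d_b], the element
    [T_(a+m)] is the conjugate of [T_b] by [T_a^-1 T_oo], and symmetrically
    ([parabolic_next]).

    These two vector identities amount to quadratic relations between the
    entries of v_a, v_b and v_m, collected in [farey_triple]. The recursion
    carries them from a triple to its children in the Farey tree
    ([farey_triple_next]), and they hold for 0, oo and 1. Hence [T] lies in Gamma
    all over the tree, and the subtractive Euclidean algorithm
    ([node_descent]) finds every rational of [0, 1] in the tree. Finally
    [S_a = T_a^-1 U_0^-1] lies in Gamma as soon as [T_a] does. *)

(** * Transvections in PSL2 *)

Section Transvections.
Variable F : fieldType.
Implicit Types e f n q r s c : F.

Lemma mx2M (R : comNzRingType) (a b c d a' b' c' d' : R) :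
  mx2 a b c d *m mx2 a' b' c' d' =
  mx2 (a * a' + b * c') (a * b' + b * d') (c * a' + d * c') (c * b' + d * d').
Proof.
apply/matrixP=> i j; rewrite !mxE !big_ord_recl big_ord0 addr0 !mxE /=.
by case: i => -[|[|//]] ?; case: j => -[|[|//]] ?.
Qed.

Fact transv_subproof e n q :
  \det (mx2 (1 + e * n * q) (- (e * n ^+ 2)) (e * q ^+ 2) (1 - e * n * q)) == 1.
Proof. by rewrite det_mx2; apply/eqP; ring. Qed.

Definition transv_SL2 e n q : SL2 F := MkSL2 (transv_subproof e n q).

Definition transv e n q : PSL2 F := \pi_(PSL2 F) (transv_SL2 e n q).

Lemma transv_upper e : transv e 1 0 = PSL2_upper (- e).
Proof.
by congr (\pi_(PSL2 F) _); apply: val_inj; congr mx2; ring.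
Qed.

Lemma transv_lower e : transv e 0 1 = PSL2_lower e.
Proof.
by congr (\pi_(PSL2 F) _); apply: val_inj; congr mx2; ring.
Qed.

(** Transvections with proportional vectors differ only by a square in their
    coefficient. This absorbs the scalar by which the Farey recursion differs
    from the action of Gamma. *)
Lemma transvZ e c n q : transv e (c * n) (c * q) = transv (c ^+ 2 * e) n q.
Proof.
by congr (\pi_(PSL2 F) _); apply: val_inj; congr mx2; ring.
Qed.

Lemma transvV e n q : (transv e n q)^-1%g = transv (- e) n q.
Proof.
apply/esym/eqP; rewrite -mulg_eq1 PSL2_piM; apply/eqP.
congr (\pi_(PSL2 F) _); apply: val_inj => /=; rewrite mx2M.
have ->: 1%:M = mx2 1 0 0 1 :> 'M[F]_2.
  apply/matrixP=> i j; rewrite !mxE.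
  by case: i => -[|[|//]] ?; case: j => -[|[|//]] ?.
by congr mx2; ring.
Qed.

(** [g (1 + e v w) g^-1 = 1 + e (g v) (w g^-1)], and for [g] of determinant 1 the
    covector dual to [v] becomes the one dual to [g v]; the new entries on the
    right are those of [g v]. *)
Lemma transvJ f r s e n q :
  (transv f r s * transv e n q * (transv f r s)^-1)%g =
  transv e (n + f * (n * s - q * r) * r) (q + f * (n * s - q * r) * s).
Proof.
apply/eqP; rewrite divg_eq !PSL2_piM; apply/eqP.
congr (\pi_(PSL2 F) _); apply: val_inj => /=; rewrite !mx2M.
by congr mx2; ring.
Qed.

End Transvections.

(** * Relations between a Farey pair and its mediant *)

Section FareyTriples.
Variable F : fieldType.

Record slope_data : Type := SlopeData { sN : F; sQ : F; sd : F }.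

Implicit Types a b m : slope_data.

Definition cross a b : F := sN a * sQ b - sN b * sQ a.

(** The relations that make [v_m] behave like a mediant of [v_a] and [v_b]. The
    sign [eps] is [1] when [a < b] and [-1] when [b < a]: exchanging [a] and [b]
    negates [cross], so a single orientation has to be treated below. *)
Record farey_triple (eps : F) a b m : Prop := FareyTriple {
  triple_d : sd m = sd a * sd b;
  triple_Q : sQ m = sQ a * sQ b + eps * cross b a;
  triple_crossl : cross a m = eps * (sd a * sQ b);
  triple_crossr : cross m b = eps * (sd b * sQ a) }.

Definition next_data a b m : slope_data :=
  SlopeData (- sd a * sN b + sQ a * sN m) (- sd a * sQ b + sQ a * sQ m)
            (sd a * sd m).

Lemma farey_triple_sym eps a b m :
  farey_triple eps a b m -> farey_triple (- eps) b a m.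
Proof.
case: a b m => [na qa da] [nb qb db] [nm qm dm] [/= hd hQ hl hr].
rewrite /cross /= in hQ hl hr *.
split; rewrite /cross /=; [by rewrite hd mulrC | by rewrite hQ; ring | |].
  by rewrite mulNr -hr; ring.
by rewrite mulNr -hl; ring.
Qed.

(** After substituting [v_(a+m) = - d_a v_b + Q_a v_m], each relation of the new
    triple is a linear combination of those of the old one. *)
Lemma farey_triple_next eps a b m : eps ^+ 2 = 1 ->
  farey_triple eps a b m -> farey_triple eps a m (next_data a b m).
Proof.
case: a b m => [na qa da] [nb qb db] [nm qm dm] eps2 [/= hd hQ hl hr].
rewrite /cross /= in hQ hl hr *.
have epsK x : eps * (eps * x) = x by rewrite mulrA -expr2 eps2 mul1r.
split; rewrite /cross //=.
- have ->: nm * qa - na * qm = - (eps * (da * qb)) by rewrite -hl; ring.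
  by rewrite mulrN epsK; ring.
- transitivity (qa * (na * qm - nm * qa) + da * (nb * qa - na * qb)); first by ring.
  by rewrite hl hQ -[da * (nb * qa - _)]epsK; ring.
- transitivity (da * (nm * qb - nb * qm)); first by ring.
  by rewrite hr hd; ring.
Qed.

Definition parabolic a : PSL2 F := transv (sd a)^-1 (sN a) (sQ a).

(** The relations of the triple give
    [T_a^-eps T_oo^eps v_b = - d_a^-1 v_(a+m)], while the coefficient changes
    from [d_b^-1] to [d_a^-2 d_b^-1]. The factor [transv (- eps * 1) 1 0] is
    [T_oo^eps]. *)
Lemma parabolic_next eps a b m : eps ^+ 2 = 1 -> sd a != 0 ->
  farey_triple eps a b m ->
  parabolic (next_data a b m) =
  (transv (- eps * (sd a)^-1) (sN a) (sQ a) *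
   (transv (- eps * 1) 1 0 * parabolic b * (transv (- eps * 1) 1 0)^-1) *
   (transv (- eps * (sd a)^-1) (sN a) (sQ a))^-1)%g.
Proof.
case: a b m => [na qa da] [nb qb db] [nm qm dm] eps2 /= da0 [/= hd hQ hl hr].
rewrite /parabolic /= !transvJ.
rewrite /cross /= in hQ hl hr *.
have epsK x : eps * (eps * x) = x by rewrite mulrA -expr2 eps2 mul1r.
set n1 := nb + _; set q1 := qb + _.
have -> : q1 = qb by rewrite /q1; ring.
have -> : n1 = nb + eps * qb by rewrite /n1; ring.
(* The cross product of [T_oo^eps v_b] with [v_a] is [eps * Q m]. *)
have key : (nb + eps * qb) * qa - qb * na = eps * qm.
  by rewrite hQ mulrDr epsK; ring.
rewrite key hd.
have -> : - eps / da * (eps * qm) = - (da^-1 * qm).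
  by rewrite -[in RHS](epsK qm); ring.
have -> : nb + eps * qb + - (da^-1 * qm) * na = - da^-1 * (- da * nb + qa * nm).
  have -> : qa * nm = na * qm - eps * (da * qb) by rewrite -hl; ring.
  by field.
have -> : qb + - (da^-1 * qm) * qa = - da^-1 * (- da * qb + qa * qm) by field.
rewrite transvZ; congr (transv _ _ _).
by rewrite !invfM; ring.
Qed.

End FareyTriples.

(** * Mediants of rationals *)

Definition mediant (a b : rat) : rat :=
  (numq a + numq b)%:Q / (denq a + denq b)%:Q.

(** The boolean records which endpoint is the smaller one, so that both children
    of a node are handled through the symmetry [adjacent_sym]. *)
Definition adjacent (s : bool) (a b : rat) : Prop :=
  numq b * denq a - numq a * denq b = (-1) ^+ s.

Lemma mediantC a b : mediant a b = mediant b a.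
Proof. by rewrite /mediant [numq a + _]addrC [denq a + _]addrC. Qed.

Lemma oplus_mediant a b : oplus (Some a) (Some b) = Some (mediant a b).
Proof.
rewrite /oplus /= ifF //; apply/eqP.
by have := denq_gt0 a; have := denq_gt0 b; lia.
Qed.

(** The adjacency relation is preserved by adding [a] to [b], so it is a Bezout
    relation for the mediant fraction, which is thus in lowest terms. *)
Lemma num_den_mediant s a b : adjacent s a b ->
  numq (mediant a b) = numq a + numq b /\ denq (mediant a b) = denq a + denq b.
Proof.
rewrite /adjacent => adj.
have d_gt0 : 0 < denq a + denq b by rewrite addr_gt0 ?denq_gt0.
have cop : coprimez (numq a + numq b) (denq a + denq b).
  apply/coprimezP; exists ((-1) ^+ s * denq a, - ((-1) ^+ s * numq a)) => /=.
  transitivity ((-1) ^+ s * (numq b * denq a - numq a * denq b) : int).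
    by ring.
  by rewrite adj -expr2 sqrr_sign.
rewrite /mediant coprimeq_num // coprimeq_den //; split.
  by rewrite gtr0_sg // mul1r.
by rewrite gt_eqF // gtr0_norm.
Qed.

Lemma adjacent_sym s a b : adjacent s a b -> adjacent (~~ s) b a.
Proof.
by rewrite /adjacent signrN => <-; ring.
Qed.

Lemma adjacent_mediant s a b : adjacent s a b -> adjacent s a (mediant a b).
Proof.
move=> adj; have [hn hd] := num_den_mediant adj.
by rewrite /adjacent hn hd -adj; ring.
Qed.

Lemma inQ0E a : inQ0 a = (0 <= numq a <= denq a).
Proof.
rewrite /inQ0 numq_ge0; congr (_ && _).
by rewrite -[a in LHS]divq_num_den ler_pdivrMr ?ltr0z ?denq_gt0 // mul1r ler_int.
Qed.

Lemma inQ0_mediant s a b : adjacent s a b -> inQ0 a -> inQ0 b ->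
  inQ0 (mediant a b).
Proof.
move=> /num_den_mediant[hn hd]; rewrite !inQ0E hn hd; lia.
Qed.

Lemma adjacent_farey s a b : adjacent s a b -> inQ0 a -> inQ0 b ->
  farey_pair (Some a) (Some b).
Proof.
rewrite /adjacent => adj ha hb; split=> //=.
by case: s adj; rewrite ?expr1 ?expr0; lia.
Qed.

Lemma dQ_mediant s a b : adjacent s a b -> inQ0 a -> inQ0 b ->
  dQ (Some (mediant a b)) = dQ (Some a) * dQ (Some b).
Proof.
move=> /num_den_mediant[hn hd]; rewrite !inQ0E => /andP[ha _] /andP[hb _].
have := denq_gt0 a; have := denq_gt0 b => db da.
rewrite /dQ /= hn hd.
have -> : absz (numq a + numq b) = (absz (numq a) + absz (numq b))%N by lia.
have -> : absz (denq a + denq b) = (absz (denq a) + absz (denq b))%N by lia.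
by rewrite !exprD; ring.
Qed.

Lemma dQ_at0 a : (dQ (Some a)).[0] = 0.
Proof.
rewrite /dQ /= hornerM hornerXn expr0n.
by rewrite absz_eq0 denq_eq0 mulr0.
Qed.

Lemma rat_cross_eq a b : numq a * denq b = numq b * denq a -> a = b.
Proof.
move=> h; rewrite -[a]divq_num_den -[b]divq_num_den; apply/eqP.
by rewrite eqr_div ?intr_eq0 ?denq_neq0 // -!intrM h.
Qed.

(** * The slopes under Farey recursion *)

Lemma toQxM p q : toQx (p * q) = toQx p * toQx q.
Proof. by rewrite /toQx !rmorphM. Qed.
Lemma toQxD p q : toQx (p + q) = toQx p + toQx q.
Proof. by rewrite /toQx !rmorphD. Qed.
Lemma toQxN p : toQx (- p) = - toQx p.
Proof. by rewrite /toQx !rmorphN. Qed.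
Lemma toQx0 : toQx 0 = 0.
Proof. by rewrite /toQx !rmorph0. Qed.
Lemma toQx1 : toQx 1 = 1.
Proof. by rewrite /toQx !rmorph1. Qed.

Lemma toQx_eq0 p : (toQx p == 0) = (p == 0).
Proof.
rewrite /toQx tofrac_eq0; apply/eqP/eqP => [h|->]; last by rewrite rmorph0.
apply/polyP=> i; apply: (@intr_inj rat).
by move/polyP/(_ i): h; rewrite coef_map_id0 // !coef0.
Qed.

Section Descent.
Variables Q N : erat -> {poly int}.
Hypothesis hQN : farey_QN Q N.

Definition slope (e : erat) : slope_data Qx :=
  SlopeData (toQx (N e)) (toQx (Q e)) (toQx (dQ e)).

Lemma slope_d_neq0 e : sd (slope e) != 0.
Proof. by rewrite toQx_eq0 /dQ mulf_neq0 ?signr_eq0 // expf_neq0 // polyX_eq0. Qed.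

Lemma toQx_dQ_inf : toQx (dQ None) = -1.
Proof. by rewrite /dQ /= expr1 expr0 mulr1 toQxN toQx1. Qed.

(** The recursion speaks of [Q] and [N] only. That [d] is multiplicative needs
    mediants in lowest terms, hence the last hypothesis, met by [dQ_mediant]. *)
Lemma slope_next b g r : farey_pair b g -> oplusn 2 g b = Some r -> inQ0 r ->
  dQ (Some r) = dQ b * dQ (oplusn 1 g b) ->
  slope (Some r) = next_data (slope b) (slope g) (slope (oplusn 1 g b)).
Proof.
move=> bg gr hr hd.
have hex : exists2 r', oplusn 2 g b = Some r' & inQ0 r' by exists r.
have hQ := Q_rec hQN bg hex; have hN := N_rec hQN bg hex.
rewrite gr in hQ hN; rewrite /slope /next_data hd hQ hN.
by move: (dQ b) (dQ _) => D D'; rewrite !toQxD !toQxM !toQxN.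
Qed.

(** The constant term is kept along with membership because [parabolic] agrees
    with [T_elt] only where [Q] does not vanish. *)
Record certified (a : rat) : Prop := Certified {
  certified_Q : (Q (Some a)).[0] = 1;
  certified_mem : Gamma (parabolic (slope (Some a))) }.

Record farey_node (s : bool) (a b : rat) : Prop := FareyNode {
  node_l : inQ0 a;
  node_r : inQ0 b;
  node_adj : adjacent s a b;
  node_triple : farey_triple ((-1) ^+ s) (slope (Some a)) (slope (Some b))
                  (slope (Some (mediant a b)));
  node_gl : certified a;
  node_gr : certified b;
  node_gm : certified (mediant a b) }.

Lemma node_sym s a b : farey_node s a b -> farey_node (~~ s) b a.
Proof.
case=> ha hb adj tr ga gb gm; split=> //.
- exact: adjacent_sym.
- by rewrite signrN mediantC; apply: farey_triple_sym.
- by rewrite mediantC.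
Qed.

Lemma Gamma_transv_sign (s : bool) e n q : Gamma (transv e n q) ->
  Gamma (transv (- (-1) ^+ s * e) n q).
Proof.
move=> h; case: s; rewrite ?expr1 ?expr0 ?opprK ?mul1r ?mulN1r //.
by rewrite -transvV; apply: generated_V.
Qed.

Lemma Gamma_conj g h : Gamma g -> Gamma h -> Gamma (g * h * g^-1)%g.
Proof.
move=> hg hh; apply: generated_M; last exact: generated_V.
exact: generated_M.
Qed.

Lemma U0E : transv 1 1 0 = U0.
Proof. by rewrite transv_upper. Qed.

Lemma Gamma_next (s : bool) a b m : farey_triple ((-1) ^+ s) (slope a) (slope b) m ->
  Gamma (parabolic (slope a)) -> Gamma (parabolic (slope b)) ->
  Gamma (parabolic (next_data (slope a) (slope b) m)).
Proof.
move=> tr ga gb.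
rewrite (parabolic_next (sqrr_sign _ _) (slope_d_neq0 a) tr).
apply: Gamma_conj; first exact: Gamma_transv_sign.
apply: Gamma_conj => //; apply: Gamma_transv_sign.
by apply: generated_mem; left; apply: U0E.
Qed.

(** The recursion at [beta = a], [gamma = b] produces the mediant of [a] and of the
    mediant of [a] and [b]. *)
Lemma node_child s a b : farey_node s a b -> farey_node s a (mediant a b).
Proof.
case=> ha hb adj tr ga gb gm.
have adj' := adjacent_mediant adj.
have hm := inQ0_mediant adj ha hb.
have hm' := inQ0_mediant adj' ha hm.
have bg := adjacent_farey adj ha hb.
have o1 : oplusn 1 (Some b) (Some a) = Some (mediant a b).
  by rewrite /oplusn /= oplus_mediant mediantC.
have o2 : oplusn 2 (Some b) (Some a) = Some (mediant a (mediant a b)).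
  by rewrite /oplusn /= !oplus_mediant mediantC [mediant b a]mediantC.
have nx : slope (Some (mediant a (mediant a b))) =
    next_data (slope (Some a)) (slope (Some b)) (slope (Some (mediant a b))).
  by rewrite -o1; apply: slope_next => //; rewrite o1; apply: (dQ_mediant (s := s)).
split=> //; first by rewrite nx; apply: farey_triple_next; rewrite ?sqrr_sign.
split.
  have hex : exists2 r', oplusn 2 (Some b) (Some a) = Some r' & inQ0 r'.
    by eexists; first exact: o2.
  rewrite -o2 (Q_rec hQN bg hex) o1 hornerD !hornerM hornerN dQ_at0.
  by rewrite (certified_Q ga) (certified_Q gm) oppr0 mul0r add0r mulr1.
rewrite nx; apply: (Gamma_next (s := s)) => //; exact: certified_mem.
Qed.

(** [W^-1] is the transvection with vector (0, 1), which [U^-1] moves to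
    [(V, 1) = (N, Q) / Q]; rescaling by [Q] cancels the factor [Q^2] in [W]. *)
Lemma T_eltE w : toQx (Q (Some w)) != 0 ->
  T_elt Q N w = parabolic (slope (Some w)).
Proof.
move=> q0; rewrite /T_elt.
have -> : U_elt Q N w = ((transv (- V_val Q N w) 1 0)^-1)%g.
  by rewrite transvV opprK transv_upper.
rewrite invgK /W_elt -transv_lower transvV opprK transvJ /parabolic /V_val.
rewrite [sN _]/= [sQ _]/= [sd _]/=.
move: (toQx (Q _)) (toQx (N _)) (toQx (dQ _)) q0 => q n d q0.
have -> : 0 + - (n / q) * (0 * 0 - 1 * 1) * 1 = q^-1 * n by ring.
have -> : 1 + - (n / q) * (0 * 0 - 1 * 1) * 0 = q^-1 * q by rewrite mulVf //; ring.
by rewrite transvZ mulrA -exprMn mulVf // expr1n mul1r.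
Qed.

Lemma parabolic_inf : parabolic (slope None) = U0^-1%g.
Proof.
rewrite -U0E transvV /parabolic /= (N_inf hQN) (Q_inf hQN) toQx1 toQx0.
by rewrite toQx_dQ_inf invrN invr1.
Qed.

Lemma parabolic_0 : parabolic (slope (Some 0)) = (U0^-1 * W0^-1 * U0)%g.
Proof.
rewrite -T_eltE /T_elt ?(U_at0 hQN) ?(W_at0 hQN) //.
by rewrite (Q_0 hQN) toQx1 oner_neq0.
Qed.

(** The slopes 0 and 1 have the same vector, and [d] takes opposite values. *)
Lemma parabolic_1 : parabolic (slope (Some 1)) = (parabolic (slope (Some 0)))^-1%g.
Proof.
rewrite /parabolic transvV /= (N_0 hQN) (Q_0 hQN) (N_1 hQN) (Q_1 hQN).
by rewrite -invrN -toQxN /dQ /= expr0 expr1 mulN1r mul1r.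
Qed.

(** The triple (0, oo, 1) is the true root. The pair (0, 1) is obtained from it as
    a child, since 1/2 comes from the recursion at [beta = 0], [gamma = oo]. *)
Lemma node_root : farey_node false 0 1.
Proof.
have GU : Gamma U0 by apply: generated_mem; left.
have GW : Gamma W0 by apply: generated_mem; right.
have G0 : Gamma (parabolic (slope (Some 0))).
  rewrite parabolic_0 -{2}[U0]invgK; apply: Gamma_conj; exact: generated_V.
have Ginf : Gamma (parabolic (slope None)).
  by rewrite parabolic_inf; apply: generated_V.
have o1 : oplusn 1 None (Some 0) = Some 1 by [].
have o2 : oplusn 2 None (Some 0) = Some (mediant 0 1) by [].
have adj : adjacent false 0 1 by [].
have bg : farey_pair (Some 0) None by split=> //=; right.
have hm : inQ0 (mediant 0 1) by [].
have nx : slope (Some (mediant 0 1)) =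
    next_data (slope (Some 0)) (slope None) (slope (Some 1)).
  by rewrite -o1; apply: slope_next => //; rewrite o1; apply: (dQ_mediant (s := false)).
have tr : farey_triple ((-1) ^+ false) (slope (Some 0)) (slope None) (slope (Some 1)).
  rewrite expr0; split; rewrite /cross /= ?(N_0 hQN) ?(Q_0 hQN) ?(N_1 hQN)
    ?(Q_1 hQN) ?(N_inf hQN) ?(Q_inf hQN) ?toQx1 ?toQx0.
  - by rewrite -toQxM /dQ /= !expr0 !expr1; congr toQx; ring.
  - by ring.
  - by ring.
  - by rewrite toQx_dQ_inf; ring.
split=> //.
- by rewrite nx; apply: farey_triple_next; rewrite ?sqrr_sign.
- by split=> //; rewrite (Q_0 hQN) hornerC.
- split; first by rewrite (Q_1 hQN) hornerC.
  by rewrite parabolic_1; apply: generated_V.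
split; last by rewrite nx; apply: (Gamma_next (s := false)).
have hex : exists2 r', oplusn 2 None (Some 0) = Some r' & inQ0 r'.
  by eexists; first exact: o2.
rewrite -o2 (Q_rec hQN bg hex) o1 (Q_inf hQN) (Q_0 hQN) (Q_1 hQN).
by rewrite mulr0 add0r mulr1 hornerC.
Qed.

(** Write A and B for the two cross products of [w] with [a] and [b]; both are
    nonnegative since [a <= w <= b]. Passing to a child replaces (A, B) by
    (A, B - A) or (A - B, B), according to the side of the mediant on which [w]
    lies, so A + B decreases until [w] is an endpoint or the mediant. *)
Lemma node_descent k a b w : farey_node false a b ->
  0 <= numq w * denq a - numq a * denq w ->
  0 <= numq b * denq w - numq w * denq b ->
  numq w * denq a - numq a * denq w + (numq b * denq w - numq w * denq b) < k%:Z ->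
  certified w.
Proof.
elim: k a b => [|k IHk] a b nd; first by lia.
set A := numq w * denq a - _; set B := numq b * denq w - _ => A_ge0 B_ge0 ABk.
have [A0|A_neq0] := eqVneq A 0.
  rewrite (_ : w = a); first exact: node_gl nd.
  by apply: rat_cross_eq; lia.
have [B0|B_neq0] := eqVneq B 0.
  rewrite (_ : w = b); first exact: node_gr nd.
  by apply: rat_cross_eq; lia.
have [hn hd] := num_den_mediant (node_adj nd).
case: (ltrgtP A B) => [AB|BA|AB].
- by apply: (IHk a (mediant a b) (node_child nd)); rewrite ?hn ?hd; lia.
- have nd' : farey_node false (mediant a b) b.
    by rewrite mediantC; exact: node_sym (node_child (node_sym nd)).
  by apply: (IHk _ _ nd'); rewrite ?hn ?hd; lia.
rewrite (_ : w = mediant a b); first exact: node_gm nd.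
by apply: rat_cross_eq; rewrite hn hd; lia.
Qed.

Lemma certified_inQ0 w : inQ0 w -> certified w.
Proof.
rewrite inQ0E => hw.
have [n0 d0] : numq 0 = 0 /\ denq 0 = 1 by [].
have [n1 d1] : numq 1 = 1 /\ denq 1 = 1 by [].
apply: (node_descent (k := (absz (denq w)).+1) node_root).
all: rewrite ?n0 ?d0 ?n1 ?d1; lia.
Qed.

End Descent.

Theorem theorem5p28 (Q N : erat -> {poly int}) (hQN : farey_QN Q N)
    (beta : rat) (hbeta : 0 <= beta <= 1 / 2) :
  Gamma (S_elt Q N beta) /\ Gamma (T_elt Q N beta).
Proof.
have hb : inQ0 beta.
  case/andP: hbeta => b0 b1; rewrite /inQ0 b0 /=.
  by apply: le_trans b1 _.
have [hQ hT] := certified_inQ0 hQN hb.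
have q0 : toQx (Q (Some beta)) != 0.
  by rewrite toQx_eq0; apply: contra_eq_neq hQ => ->; rewrite hornerC.
rewrite -T_eltE // in hT.
split=> //; apply: generated_M; apply: generated_V => //.
by rewrite (U_at0 hQN); apply: generated_mem; left.
Qed.
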